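(* Let $F_1,F_2:(\mathbb{R}^M,0)\to(\mathbb{R}^N,0)$ be analytic map germs that are $C^\infty$-$\mathcal{L}$-equivalent, i.e. there is a $C^\infty$ diffeomorphism germ $G:(\mathbb{R}^N,0)\to(\mathbb{R}^N,0)$ with $F_1=G\circ F_2$. Then $M(F_1)=M(F_2)$. Furthermore, $F_1$ is tame if and only if $F_2$ is tame.
   Context: $M\ge N\ge 2$; map germs are non-constant and all sets are considered as germs at the origin. For a map germ $F:(\mathbb{R}^M,0)\to(\mathbb{R}^N,0)$, put $V_F=F^{-1}(0)$ and let $\mathrm{Sing}\,F$ be the set of points $x$ where the Jacobian matrix $\mathrm{d}F(x)$ does not have maximal rank (rank less than $N$, i.e. $F$ is not a submersion at $x$). Fix a smooth nonnegative proper function $\rho:U\to\mathbb{R}_{\ge0}$, defined on an open neighbourhood $U$ of $0\in\mathbb{R}^M$ and vanishing only at the origin (for example $\rho(x)=\|x\|^2$). The Milnor set is $M(F)=M_\rho(F)=\mathrm{Sing}(F,\rho)$, the set of points where $(F,\rho)$ is not a submersion to $\mathbb{R}^{N+1}$. $F$ is tame (with respect to $\rho$) if $\overline{M(F)\setminus V_F}\cap V_F\subseteq\{0\}$ as set germs at the origin. The same $\rho$ is used for $F_1$ and $F_2$. *)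

(* Defs.v *)
From HB Require Import structures.
From mathcomp Require Import all_boot all_order all_algebra.
From mathcomp Require Import all_classical all_reals all_analysis.
Set Implicit Arguments.
Unset Strict Implicit.
Unset Printing Implicit Defensive.
Import Order.TTheory GRing.Theory Num.Theory.
Import numFieldNormedType.Exports.
Local Open Scope classical_set_scope.
Local Open Scope ring_scope.

(* A germ at the origin is represented by a total function (or a set); only the
   values near 0 are ever constrained, and all relations between germs below are
   of the form [\forall x \near 0, _]. *)

Definition germ_eq (R : realType) (n : nat) (A B : set 'rV[R]_n) : Prop :=
  \forall x \near (0 : 'rV[R]_n), A x <-> B x.

Definition germ_sub (R : realType) (n : nat) (A B : set 'rV[R]_n) : Prop :=
  \forall x \near (0 : 'rV[R]_n), A x -> B x.

Definition nonconstant_germ (R : realType) (M N : nat)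
    (F : 'rV[R]_M -> 'rV[R]_N) : Prop :=
  ~ (\forall x \near (0 : 'rV[R]_M), F x = F 0).

(* The derivative of f is of class C^k iff all the directional derivatives
   ['D_v f] are, because the source space is finite-dimensional. *)
Fixpoint Ck_on (R : realType) (n : nat) (W : normedModType R) (k : nat)
    (U : set 'rV[R]_n) (f : 'rV[R]_n -> W) {struct k} : Prop :=
  match k with
  | 0%N => forall x, U x -> {for x, continuous f}
  | k'.+1 => (forall x, U x -> differentiable f x) /\
             (forall v : 'rV[R]_n, Ck_on k' U ('D_v f))
  end.

Definition smooth_on (R : realType) (n : nat) (W : normedModType R)
    (U : set 'rV[R]_n) (f : 'rV[R]_n -> W) : Prop :=
  forall k : nat, Ck_on k U f.

Definition smooth_germ (R : realType) (n : nat) (W : normedModType R)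
    (f : 'rV[R]_n -> W) : Prop :=
  exists2 U : set 'rV[R]_n, open U /\ U 0 & smooth_on U f.

Definition diffeo_germ (R : realType) (n : nat)
    (G : 'rV[R]_n -> 'rV[R]_n) : Prop :=
  [/\ G 0 = 0, smooth_germ G &
    exists H : 'rV[R]_n -> 'rV[R]_n,
      [/\ H 0 = 0, smooth_germ H,
          \forall y \near (0 : 'rV[R]_n), H (G y) = y &
          \forall y \near (0 : 'rV[R]_n), G (H y) = y]].

Definition L_equivalent (R : realType) (M N : nat)
    (F1 F2 : 'rV[R]_M -> 'rV[R]_N) : Prop :=
  exists2 G : 'rV[R]_N -> 'rV[R]_N, diffeo_germ G &
    \forall x \near (0 : 'rV[R]_M), F1 x = G (F2 x).

Definition monomial (R : realType) (n : nat) (h : 'rV[R]_n)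
    (al : {ffun 'I_n -> nat}) : R :=
  \prod_(i < n) h 0 i ^+ al i.

(* f is the sum of an absolutely convergent power series centred at a, on a
   neighbourhood of a. Since the family is absolutely summable, its sum can be
   computed as the limit of the sums over the multi-indices in {0,..,K-1}^n. *)
Definition analytic_at (R : realType) (n : nat) (f : 'rV[R]_n -> R)
    (a : 'rV[R]_n) : Prop :=
  exists c : {ffun 'I_n -> nat} -> R, \forall x \near a,
    summable [set: {ffun 'I_n -> nat}]
      (fun al => (c al * monomial (x - a) al)%:E) /\
    (\sum_(be : {ffun 'I_n -> 'I_K})
       c [ffun i => nat_of_ord (be i)] *
       monomial (x - a) [ffun i => nat_of_ord (be i)]) @[K --> \oo] --> f x.

Definition analytic_map_germ (R : realType) (M N : nat)
    (F : 'rV[R]_M -> 'rV[R]_N) : Prop :=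
  F 0 = 0 /\
  \forall a \near (0 : 'rV[R]_M), forall j : 'I_N,
    analytic_at (fun x => F x 0 j) a.

Definition zero_set (R : realType) (M N : nat)
    (F : 'rV[R]_M -> 'rV[R]_N) : set 'rV[R]_M :=
  F @^-1` [set 0].

Definition Sing (R : realType) (M N : nat)
    (F : 'rV[R]_M -> 'rV[R]_N) : set 'rV[R]_M :=
  [set x | (\rank ('J F x) < N)%N].

Definition with_rho (R : realType) (M N : nat) (rho : 'rV[R]_M -> R)
    (F : 'rV[R]_M -> 'rV[R]_N) : 'rV[R]_M -> 'rV[R]_(N + 1) :=
  fun x => row_mx (F x) (const_mx (rho x)).

Definition Milnor_set (R : realType) (M N : nat) (rho : 'rV[R]_M -> R)
    (F : 'rV[R]_M -> 'rV[R]_N) : set 'rV[R]_M :=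
  Sing (with_rho rho F).

Definition tame (R : realType) (M N : nat) (rho : 'rV[R]_M -> R)
    (F : 'rV[R]_M -> 'rV[R]_N) : Prop :=
  germ_sub (closure (Milnor_set rho F `\` zero_set F) `&` zero_set F) [set 0].

(* The last clause is the properness of rho : U -> [0, +oo[. *)
Definition control_function (R : realType) (M : nat) (U : set 'rV[R]_M)
    (rho : 'rV[R]_M -> R) : Prop :=
  [/\ open U /\ U 0,
      smooth_on U rho,
      forall x, U x -> 0 <= rho x,
      forall x, U x -> (rho x = 0 <-> x = 0) &
      forall K : set R, K `<=` [set r | 0 <= r] -> compact K ->
        compact (U `&` rho @^-1` K)].

(* Main.v *)
(** If [F1 = G o F2] then [(F1, rho) = (G x id) o (F2, rho)], and conversely
    with the inverse germ of [G]; by the chain rule the Jacobian matrices of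
    [(F1, rho)] and [(F2, rho)] have the same rank at each point near the
    origin. Hence the Milnor sets agree as germs; the zero sets agree because
    [G] fixes the origin and is injective near it, and tameness only involves
    these two germs.

    Analyticity is used only through the continuity of [F1] and [F2] at the
    origin, which lets properties of [G] near [0] be pulled back. *)

Require Import Defs.
From mathcomp Require Import all_boot all_order all_algebra.
From mathcomp Require Import all_classical all_reals all_analysis.

Set Implicit Arguments.
Unset Strict Implicit.
Unset Printing Implicit Defensive.
Import Order.TTheory GRing.Theory Num.Theory.
Import numFieldNormedType.Exports.
Local Open Scope classical_set_scope.
Local Open Scope ring_scope.

(** * Differentials and ranks of Jacobian matrices *)

Lemma cvg_mx (R : realFieldType) (T : Type) (F : set_system T) {FF : Filter F}
    (m n : nat) (f : T -> 'M[R]_(m, n)) (A : 'M[R]_(m, n)) :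
  (forall i j, f x i j @[x --> F] --> A i j) -> f x @[x --> F] --> A.
Proof.
move=> fA; apply/cvgrPdist_le => e e0.
near=> x.
rewrite /Num.Def.normr/= mx_normrE (bigmax_le _ (ltW e0))//= => i _.
rewrite !mxE.
move: i; near: x; apply: filter_forall => /= i.
exact: ((cvgrPdist_le _ _).1 (fA i.1 i.2)).
Unshelve. all: by end_near. Qed.

Lemma differentiable_mulmxr (R : realFieldType) (m n : nat) (A : 'M[R]_(m, n))
    (x : 'rV[R]_m) : differentiable (fun u : 'rV[R]_m => u *m A) x.
Proof.
apply: (@linear_differentiable _ _ _ (mulmxr A)) => {}x.
apply: (@cvg_mx _ _ (nbhs x)) => i j.
rewrite mxE; under eq_fun do rewrite mxE.
apply: cvg_big => [|k _]; first exact: add_continuous.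
by apply: cvgMr_tmp; exact: coord_continuous.
Qed.

(** The first-order expansion of [f] at [x] is also one for [g], and the linear part of such an
    expansion is unique. *)
Lemma near_differentiable (R : numFieldType) (V W : normedModType R)
    (f g : V -> W) (x : V) :
  (\forall y \near x, f y = g y) -> differentiable f x ->
  differentiable g x /\ 'd g x = 'd f x :> (V -> W).
Proof.
move=> fg df; have cdf := diff_continuous df.
have dg : g \o shift x = cst (g x) + 'd f x +o_ 0 id.
  apply/eqaddoP => e e0; have /eqaddoP/(_ e e0) := diff_locally df.
  move: (fg); rewrite [X in X -> _](near_shift 0) subr0.
  apply: filterS2 => h /=; rewrite !fctE/= => <-.
  by rewrite (nbhs_singleton fg).
have dgE := diff_unique cdf dg.
split; last exact: dgE.
apply/diff_locallyP; rewrite dgE; split; [exact: cdf|exact: dg].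
Qed.

(* ['d f x] is picked by [get], so it is the same junk value for all functions
   that are not differentiable at [x]; this spares us the proof that analytic
   maps are differentiable. *)
Lemma diff_nondifferentiable (R : numFieldType) (V W : normedModType R)
    (f : V -> W) (x : V) :
  ~ differentiable f x -> 'd f x = point :> {linear V -> W}.
Proof.
move=> nf; rewrite /diff; apply: getPN => d Pd; apply: nf; apply/diffP.
rewrite /diff.
(* The predicate defining ['d f x] is recovered by matching; since [d] satisfies it, so does the
   value chosen by [get]. *)
by match goal with |- context [get ?P] =>
  change (P (get P)); apply: (@getI _ P d) end.
Qed.

(** With row vectors the chain rule puts ['J f x] on the left of the product, and a product has rank
    at most that of its left factor. *)
Lemma rank_jacobian_comp (R : numFieldType) (m n p : nat)
    (f : 'rV[R]_m -> 'rV[R]_n) (g : 'rV[R]_m -> 'rV[R]_p)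
    (h : 'rV[R]_n -> 'rV[R]_p) (x : 'rV[R]_m) :
  (\forall y \near x, g y = h (f y)) ->
  differentiable f x -> differentiable h (f x) ->
  differentiable g x /\ (\rank ('J g x) <= \rank ('J f x))%N.
Proof.
move=> ghf df dh.
have [||dg dgE] := @near_differentiable _ _ _ (h \o f) g x.
- by apply: filterS ghf.
- exact: differentiable_comp.
have Jg : 'J f x *m 'J h (f x) = 'J g x.
  apply/row_matrixP => i; rewrite !rowE mulmxA !mul_rV_lin1.
  exact: (congr1 (@^~ (delta_mx 0 i)) (esym (etrans dgE (diff_comp df dh)))).
split; first exact: dg.
by rewrite -Jg; exact: mxrankM_maxl.
Qed.

(** Differentiability passes from [f] to [g] through [h] and back through [k]. If both are
    differentiable, the two rank bounds combine; if neither is, both Jacobians come from the same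
    default differential. *)
Lemma rank_jacobian_eq (R : numFieldType) (m n : nat)
    (f g : 'rV[R]_m -> 'rV[R]_n) (h k : 'rV[R]_n -> 'rV[R]_n) (x : 'rV[R]_m) :
  (\forall y \near x, g y = h (f y)) -> (\forall y \near x, f y = k (g y)) ->
  differentiable h (f x) -> differentiable k (g x) ->
  \rank ('J f x) = \rank ('J g x).
Proof.
move=> ghf fkg dh dk.
have [df|ndf] := pselect (differentiable f x).
  have [dg gf] := rank_jacobian_comp ghf df dh.
  have [_ fg] := rank_jacobian_comp fkg dg dk.
  by apply/eqP; rewrite eqn_leq; apply/andP; split; [exact: fg | exact: gf].
have ndg : ~ differentiable g x.
  by move=> dg; apply: ndf; exact: (rank_jacobian_comp fkg dg dk).1.
by rewrite /jacobian !diff_nondifferentiable.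
Qed.

(** * Continuity of analytic germs *)

Lemma norm_monomialB (R : realType) (n : nat) (h : 'rV[R]_n)
    (al : {ffun 'I_n -> nat}) (r t : R) :
  0 <= r -> 0 <= t <= 1 -> (forall i, `|h 0 i| <= t * r) ->
  `|monomial h al - monomial 0 al| <= t * monomial (const_mx r) al.
Proof.
move=> r0 /andP[t0 t1] htr; rewrite /monomial.
under [in leRHS]eq_bigr do rewrite mxE.
have r_ge0 : 0 <= \prod_i r ^+ al i.
  by apply: prodr_ge0 => i _; exact: exprn_ge0.
(* If [al] is zero both monomials are 1. Otherwise the one at 0 vanishes, and a positive exponent
   [al i] supplies the factor [t]. *)
have [/forallP al0|/forallPn[i ali]] := boolP [forall i, al i == 0%N].
  by rewrite !big1 ?subrr ?normr0 ?mulr1// => i _; rewrite (eqP (al0 i)) expr0.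
rewrite [X in _ - X](bigD1 i)//= mxE expr0n (negPf ali) mul0r subr0 normr_prod.
rewrite (@le_trans _ _ ((\prod_i t ^+ al i) * \prod_i r ^+ al i))//.
  rewrite -big_split/=; apply: ler_prod => j _.
  by rewrite normr_ge0/= normrX -exprMn lerXn2r ?nnegrE ?mulr_ge0.
apply: ler_wpM2r => //; rewrite (bigD1 i)//= -[leRHS]mulr1.
apply: ler_pM; rewrite ?exprn_ge0 ?prodr_ge0//.
- by move=> j _; exact: exprn_ge0.
- by rewrite -(prednK (n := al i)) ?lt0n// exprS ler_piMr// exprn_ile1.
- by apply: prodr_ile1 => j _; rewrite exprn_ge0// exprn_ile1.
Qed.

Lemma sum_le_esum (R : realType) (T : choiceType) (I : finType) (e : I -> T)
    (g : T -> R) :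
  injective e -> summable [set: T] (fun x => (g x)%:E) ->
  \sum_i `|g (e i)| <= fine (\esum_(x in [set: T]) `|(g x)%:E|)%E.
Proof.
move=> e_inj; rewrite summableE => g_fin; rewrite -lee_fin fineK//.
apply: esum_ge; exists (range e).
  by split => //; apply: finite_image; exact: finite_finset.
rewrite fsbig_image; last by move=> ? ? _ _; exact: e_inj.
rewrite -sumEFin (_ : [set: I] = [set` index_enum I]); last first.
  by apply/seteqP; split => i _ //=; rewrite mem_index_enum.
by rewrite -fsbig_seq ?index_enum_uniq.
Qed.

(* For [`|a - x| <= r], each term of the power series at [x] differs from its
   value at [a] by at most [`|a - x| / r] times its absolute value at the corner
   [a + (r, .., r)], where the series converges absolutely. *)
Lemma analytic_at_lipschitz (R : realType) (n : nat) (f : 'rV[R]_n -> R)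
    (a : 'rV[R]_n) :
  analytic_at f a ->
  exists C : R, \forall x \near a, `|f a - f x| <= `|a - x| * C.
Proof.
move=> [c /nbhs_ballP[e /= e0 ce]].
have [r r0 re] : exists2 r : R, 0 < r & r < e.
  by exists (e / 2); rewrite ?divr_gt0// ltr_pdivrMr// ltr_pMr// ltr1n.
have ballP (x : 'rV[R]_n) : `|a - x| <= r -> ball a e x.
  by move=> xa; rewrite -ball_normE /= (le_lt_trans xa).
have [|smr _] := ce (a + const_mx r).
  apply: ballP; rewrite opprD addNKr normrN [leLHS]/Num.Def.normr/= mx_normrE.
  by rewrite bigmax_le ?ltW// => i _; rewrite mxE gtr0_norm.
rewrite addrC addKr in smr.
have fa := (ce a (ballxx a e0)).2; rewrite subrr in fa.
pose g al : R := c al * monomial (const_mx r) al.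
(* The ratio [t = |a - x| / r] gives [r^-1]; the other factor is the absolute sum at the corner,
   which bounds all truncated sums. *)
exists (r^-1 * fine (\esum_(al in setT) `|(g al)%:E|)%E); near=> x.
have xr : `|a - x| <= r by near: x; exact: ((cvgrPdist_le _ _).1 cvg_id).
have [_ fx] := ce x (ballP x xr).
apply: (cvgr_to_le (cvg_norm (cvgB fa fx))); near=> K => /=.
pose emb (be : {ffun 'I_n -> 'I_K}) := [ffun i => nat_of_ord (be i)].
rewrite distrC -sumrB (le_trans (ler_norm_sum _ _ _))// mulrA.
rewrite (@le_trans _ _ (`|a - x| / r * \sum_be `|g (emb be)|))//.
  rewrite mulr_sumr; apply: ler_sum => be _.
  rewrite -mulrBr !normrM mulrCA ler_wpM2l//.
  apply: (le_trans (norm_monomialB (t := `|a - x| / r) _ (ltW r0) _ _)).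
  - by rewrite divr_ge0 ?(ltW r0)//= ler_pdivrMr// mul1r.
  - move=> i; rewrite divfK ?gt_eqF// distrC [leRHS]/Num.Def.normr/= mx_normrE.
    exact: (le_bigmax _ _ (0, i)).
  - by rewrite ler_wpM2l ?ler_norm// divr_ge0 ?(ltW r0).
rewrite ler_wpM2l ?divr_ge0 ?(ltW r0)//.
apply: (sum_le_esum (e := emb) (g := g)) => // be be' /ffunP bb'.
by apply/ffunP => i; have := bb' i; rewrite !ffunE; exact: val_inj.
Unshelve. all: by end_near. Qed.

Lemma analytic_at_continuous (R : realType) (n : nat) (f : 'rV[R]_n -> R)
    (a : 'rV[R]_n) :
  analytic_at f a -> f x @[x --> a] --> f a.
Proof.
move=> /analytic_at_lipschitz[C fC].
apply/(@cvgrPdist_le _ _ _ (nbhs a)) => e e0; near=> x.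
have fx : `|f a - f x| <= `|a - x| * C by near: x.
(* [C] may fail to be positive, so it is replaced by a positive bound before dividing [e]. *)
apply: (le_trans fx); rewrite (@le_trans _ _ (`|a - x| * (`|C| + 1)))//.
  by rewrite ler_wpM2l// (le_trans (ler_norm C))// lerDl.
rewrite -ler_pdivlMr ?ltr_wpDl//.
by near: x; apply: ((cvgrPdist_le _ _).1 cvg_id); rewrite divr_gt0 ?ltr_wpDl.
Unshelve. all: by end_near. Qed.

Lemma analytic_map_germ_cvg0 (R : realType) (M N : nat)
    (F : 'rV[R]_M -> 'rV[R]_N) :
  analytic_map_germ F -> F x @[x --> (0 : 'rV[R]_M)] --> (0 : 'rV[R]_N).
Proof.
move=> [F0 /nbhs_singleton Fa].
apply: (@cvg_mx _ _ (nbhs (0 : 'rV[R]_M))) => i j.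
by have := analytic_at_continuous (Fa j); rewrite F0 ord1.
Qed.

(** * Germs of sets and left equivalence *)

Lemma smooth_germ_differentiable (R : realType) (n : nat)
    (W : normedModType R) (f : 'rV[R]_n -> W) :
  smooth_germ f -> \forall x \near (0 : 'rV[R]_n), differentiable f x.
Proof.
move=> [U [Uo U0] fU]; have := open_nbhs_nbhs (conj Uo U0).
by apply: filterS => x; exact: (fU 1%N).1.
Qed.

(** Membership of [x] in a closure depends only on the set near [x], and the two sets agree near
    every point close to 0. *)
Lemma germ_eq_closure (R : realType) (n : nat) (A B : set 'rV[R]_n) :
  germ_eq A B -> germ_eq (closure A) (closure B).
Proof.
move=> AB; have := nbhs_interior AB; rewrite /germ_eq/=.
apply: filterS => x xAB; split=> cl D /(filterI xAB) /cl[y [yA [yAB yD]]].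
  by exists y; split=> //; exact/yAB.
by exists y; split=> //; exact/yAB.
Qed.

Lemma diffeo_germ_zero (R : realType) (n : nat) (G : 'rV[R]_n -> 'rV[R]_n) :
  diffeo_germ G -> \forall y \near (0 : 'rV[R]_n), G y = 0 <-> y = 0.
Proof.
move=> [G0 _ [H [H0 _ HG _]]]; apply: filterS HG => y HGy.
by split=> [Gy0|->//]; rewrite -HGy Gy0.
Qed.

Lemma L_equivalent_sym (R : realType) (M N : nat)
    (F1 F2 : 'rV[R]_M -> 'rV[R]_N) :
  F2 x @[x --> (0 : 'rV[R]_M)] --> (0 : 'rV[R]_N) ->
  L_equivalent F1 F2 -> L_equivalent F2 F1.
Proof.
move=> F20 [G [G0 Gs [H [H0 Hs HG GH]]] F12].
exists H; first by split=> //; exists G.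
by apply: filterS2 F12 (F20 _ HG) => x ->.
Qed.

(** * The map [G x id], Milnor sets and tameness *)

Definition ext_id (R : realType) (N : nat) (G : 'rV[R]_N -> 'rV[R]_N) :
    'rV[R]_(N + 1) -> 'rV[R]_(N + 1) :=
  fun z => row_mx (G (lsubmx z)) (rsubmx z).

Lemma differentiable_ext_id (R : realType) (N : nat)
    (G : 'rV[R]_N -> 'rV[R]_N) (z : 'rV[R]_(N + 1)) :
  differentiable G (lsubmx z) -> differentiable (ext_id G) z.
Proof.
(* [P] projects onto the first [N] coordinates, [Q] includes them back, and [E] keeps only the last
   one; so [G x id] is [G] between linear maps plus a linear map. *)
pose P : 'M[R]_(N + 1, N) := col_mx 1%:M 0.
pose Q : 'M[R]_(N, N + 1) := row_mx 1%:M 0.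
pose E : 'M[R]_(N + 1) := block_mx 0 0 0 1%:M.
have PE (w : 'rV[R]_(N + 1)) : w *m P = lsubmx w.
  by rewrite -[w in LHS]hsubmxK mul_row_col mulmx1 mulmx0 addr0.
have -> : ext_id G = (mulmxr Q \o (G \o mulmxr P)) + mulmxr E.
  apply/funext => w; rewrite !fctE /= PE mul_mx_row mulmx1 mulmx0.
  rewrite -[w in w *m E]hsubmxK mul_row_block !mulmx0 !addr0 mulmx1 add0r.
  by rewrite add_row_mx addr0 add0r.
rewrite -PE => dG; apply: differentiableD; last exact: differentiable_mulmxr.
apply: differentiable_comp; last exact: differentiable_mulmxr.
by apply: differentiable_comp => //; exact: differentiable_mulmxr.
Qed.

Lemma near_with_rho (R : realType) (M N : nat) (rho : 'rV[R]_M -> R)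
    (F1 F2 : 'rV[R]_M -> 'rV[R]_N) :
  F2 x @[x --> (0 : 'rV[R]_M)] --> (0 : 'rV[R]_N) -> L_equivalent F1 F2 ->
  exists h : 'rV[R]_(N + 1) -> 'rV[R]_(N + 1),
    \forall x \near (0 : 'rV[R]_M), differentiable h (with_rho rho F2 x) /\
      \forall y \near x, with_rho rho F1 y = h (with_rho rho F2 y).
Proof.
move=> F20 [G [G0 Gs _] F12]; exists (ext_id G).
have dG : \forall x \near (0 : 'rV[R]_M), differentiable G (F2 x).
  exact: F20 (smooth_germ_differentiable Gs).
(* The Jacobian at [x] depends on values around [x], so [nbhs_interior] spreads the identity to a
   neighbourhood of each nearby [x]. *)
apply: filterS2 dG (nbhs_interior F12) => x dGx F12x; split.
  by apply: differentiable_ext_id; rewrite row_mxKl.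
by apply: filterS F12x => y; rewrite /ext_id row_mxKl row_mxKr => <-.
Qed.

Lemma germ_eq_Milnor_set (R : realType) (M N : nat) (rho : 'rV[R]_M -> R)
    (F1 F2 : 'rV[R]_M -> 'rV[R]_N) :
  F1 x @[x --> (0 : 'rV[R]_M)] --> (0 : 'rV[R]_N) ->
  F2 x @[x --> (0 : 'rV[R]_M)] --> (0 : 'rV[R]_N) ->
  L_equivalent F1 F2 ->
  germ_eq (Milnor_set rho F1) (Milnor_set rho F2).
Proof.
move=> F10 F20 F12; have F21 := L_equivalent_sym F20 F12.
have [h Hh] := near_with_rho rho F20 F12.
have [k Hk] := near_with_rho rho F10 F21.
apply: filterS2 Hh Hk => x [dh eh] [dk ek].
have rk := rank_jacobian_eq ek eh dk dh.
split; [exact: (leq_ltn_trans (eq_leq (esym rk)))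
       | exact: (leq_ltn_trans (eq_leq rk))].
Qed.

Lemma germ_eq_zero_set (R : realType) (M N : nat)
    (F1 F2 : 'rV[R]_M -> 'rV[R]_N) :
  F2 x @[x --> (0 : 'rV[R]_M)] --> (0 : 'rV[R]_N) -> L_equivalent F1 F2 ->
  germ_eq (zero_set F1) (zero_set F2).
Proof.
move=> F20 [G /diffeo_germ_zero Gz F12].
have GF2 : \forall x \near (0 : 'rV[R]_M), G (F2 x) = 0 <-> F2 x = 0.
  exact: F20 Gz.
by apply: filterS2 F12 GF2 => x F1x; rewrite /zero_set/= F1x.
Qed.

Lemma tame_germ_eq (R : realType) (M N : nat) (rho : 'rV[R]_M -> R)
    (F1 F2 : 'rV[R]_M -> 'rV[R]_N) :
  germ_eq (Milnor_set rho F1) (Milnor_set rho F2) ->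
  germ_eq (zero_set F1) (zero_set F2) -> tame rho F1 -> tame rho F2.
Proof.
move=> eM eV; rewrite /tame /germ_sub.
have /germ_eq_closure eC : germ_eq (Milnor_set rho F1 `\` zero_set F1)
    (Milnor_set rho F2 `\` zero_set F2).
  move: eM eV; rewrite /germ_eq; apply: filterS2 => x eMx eVx.
  by rewrite /setD/= eMx eVx.
move: eC eV; rewrite /germ_eq; apply: filterS3 => x eCx eVx + [xC xV]; apply.
by split; [exact/eCx | exact/eVx].
Qed.

Theorem corollary3p6 (R : realType) (M N : nat) (hN : (2 <= N)%N)
    (hMN : (N <= M)%N) (U : set 'rV[R]_M) (rho : 'rV[R]_M -> R)
    (hrho : control_function U rho) (F1 F2 : 'rV[R]_M -> 'rV[R]_N)
    (hF1 : analytic_map_germ F1) (hF1nc : nonconstant_germ F1)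
    (hF2 : analytic_map_germ F2) (hF2nc : nonconstant_germ F2)
    (hF12 : L_equivalent F1 F2) :
  germ_eq (Milnor_set rho F1) (Milnor_set rho F2) /\
  (tame rho F1 <-> tame rho F2).
Proof.
have F10 := analytic_map_germ_cvg0 hF1.
have F20 := analytic_map_germ_cvg0 hF2.
have hF21 := L_equivalent_sym F20 hF12.
have eM := germ_eq_Milnor_set rho F10 F20 hF12.
split=> //; split; apply: tame_germ_eq.
- exact: eM.
- exact: germ_eq_zero_set F20 hF12.
- exact: germ_eq_Milnor_set F20 F10 hF21.
- exact: germ_eq_zero_set F10 hF21.
Qed.
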